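(* For any infinite cardinality $\lambda$ there is a theory $T={\rm Th}(\mathcal{A}_E)$ of an $E$-combination $\mathcal{A}_E$, in a language $\Sigma$, such that $|\Sigma|=\lambda$ and $e\text{-}{\rm Sp}(T)=2^\lambda$.
   Context: All languages are relational. Given a family $(\mathcal{A}_i)_{i\in I}$ of (nonempty, pairwise disjoint) structures, where symbols missing from a language are interpreted by empty relations so that all languages may be taken to coincide, the $E$-combination $\mathcal{A}_E={\rm Comb}_E(\mathcal{A}_i)_{i\in I}$ is the disjoint union of the $\mathcal{A}_i$ (each relation symbol interpreted by the union of its interpretations) expanded by a new binary symbol $E$, interpreted as the equivalence relation whose classes are exactly the universes of the $\mathcal{A}_i$. Every $\mathcal{A}'\equiv\mathcal{A}_E$ is again an $E$-combination, of its restrictions to its $E$-classes. For $\mathcal{A}'\equiv\mathcal{A}_E$, $e\text{-}{\rm Sp}(\mathcal{A}')$ is the number of pairwise elementarily non-equivalent structures $\mathcal{B}$ such that $\mathcal{B}$ is the restriction of some $\mathcal{A}''\equiv\mathcal{A}'$ to one of its $E$-classes and $\mathcal{B}$ is not elementarily equivalent to the restriction of $\mathcal{A}'$ to any of its $E$-classes. Then $e\text{-}{\rm Sp}({\rm Th}(\mathcal{A}_E))=\sup\{e\text{-}{\rm Sp}(\mathcal{A}')\mid\mathcal{A}'\equiv\mathcal{A}_E\}$. *)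

(* Defs.v *)
From mathcomp Require Import all_boot.
From mathcomp Require Import boolp classical_sets functions cardinality.

Set Implicit Arguments.
Unset Strict Implicit.
Unset Printing Implicit Defensive.

Local Open Scope classical_set_scope.
Local Open Scope card_scope.

(* Nullary symbols are excluded: on a disjoint union they could not be
   recovered from, or restricted to, the summands. *)
Record language := Language {
  symbol :> Type;
  arity : symbol -> nat;
  arity_gt0 : forall R, 0 < arity R
}.

Record structure (S : language) := Structure {
  carrier :> Type;
  interp : forall R : S, (arity R).-tuple carrier -> Prop;
  carrier_inhabited : inhabited carrier
}.

(* First-order formulas with equality whose free variables are among the
   [n] de Bruijn indices ['I_n]; [All] binds the index [0]. *)
Inductive formula (S : language) : nat -> Type :=
| Fal n : formula S n
| Eq n : 'I_n -> 'I_n -> formula S n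
| Rel n (R : S) : (arity R).-tuple 'I_n -> formula S n
| Imp n : formula S n -> formula S n -> formula S n
| All n : formula S n.+1 -> formula S n.

Fixpoint sat (S : language) (M : structure S) (n : nat) (f : formula S n) :
    n.-tuple M -> Prop :=
  match f in formula _ n return n.-tuple M -> Prop with
  | Fal _ => fun=> False
  | Eq _ i j => fun e => tnth e i = tnth e j
  | Rel _ R v => fun e => interp (map_tuple (tnth e) v)
  | Imp _ g h => fun e => sat g e -> sat h e
  | All _ g => fun e => forall x : M, sat g (cons_tuple x e)
  end.

Definition theory (S : language) := set (formula S 0).

Definition Th (S : language) (M : structure S) : theory S :=
  [set f | sat f [tuple of [::] : seq M]].

Definition elem_equiv (S : language) (M N : structure S) : Prop :=
  Th M = Th N.

Definition induced (S : language) (M : structure S) (C : set M)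
    (C0 : C !=set0) : structure S :=
  Structure
    (fun R (t : (arity R).-tuple {x | C x}) => interp (map_tuple sval t))
    (let: ex_intro x Cx := C0 in inhabits (exist C x Cx)).

Section EExpansion.
Variable S : language.

Definition arityE (R : option S) : nat := if R is Some R then arity R else 2.

Lemma arityE_gt0 R : 0 < arityE R.
Proof. by case: R => // R; exact: arity_gt0. Qed.

Definition langE : language := Language arityE_gt0.

Definition E (M : structure langE) (x y : M) : Prop :=
  interp (R := None : langE) [tuple x; y].

Definition reduct (M : structure langE) : structure S :=
  Structure (fun R (t : (arity R).-tuple M) => interp (R := Some R : langE) t)
    (carrier_inhabited M).

(* Only meaningful when [E] is an equivalence relation on [M], which is the
   case whenever [M] is elementarily equivalent to an E-combination. *)
Definition E_class (M : structure langE) (C : set M) : Prop :=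
  exists a : M, C = [set x | E a x].

(* Here and in [e_spectrum], classes of structures are predicates rather than
   [set]s: the type [structure S] would otherwise have to live in the universe
   of [set], and carriers could then not be built from [set]s. *)
Definition is_E_restriction (M : structure langE) (B : structure S) : Prop :=
  exists (C : set (reduct M)) (C0 : C !=set0), E_class C /\ B = induced C0.

End EExpansion.

Section Combination.
Variables (S : language) (I : Type) (I0 : inhabited I) (A : I -> structure S).

Definition comb_carrier : Type := {i : I & A i}.

Lemma comb_inhabited : inhabited comb_carrier.
Proof.
by case: I0 => i; case: (carrier_inhabited (A i)) => x; exists; exists i.
Qed.

Definition comb_interp (R : langE S) :
    (arity R).-tuple comb_carrier -> Prop :=
  match R with
  | Some R => fun t => exists i (u : (arity R).-tuple (A i)),
      t = map_tuple (existT (fun i => carrier (A i)) i) u /\ interp u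
  | None => fun t => tag (tnth t ord0) = tag (tnth t ord_max)
  end.

Definition comb : structure (langE S) :=
  Structure comb_interp comb_inhabited.

End Combination.

Section Spectrum.
Variable S : language.

(* Structures are counted up to elementary equivalence, hence through their
   theories: [e-Sp M] is the cardinality of this set. *)
Definition e_spectrum (M : structure (langE S)) : set (theory S) :=
  [set t | exists B : structure S, [/\ t = Th B,
     (exists N : structure (langE S), elem_equiv N M /\ is_E_restriction N B) &
     ~ exists C : structure S, is_E_restriction M C /\ elem_equiv B C]].

(* [e-Sp T] is the cardinality of [X]: it is the least cardinal bounding the
   spectra of the models of the complete theory [T]. *)
Definition e_Sp_is (T : theory (langE S)) (X : Type) : Prop :=
  (forall M : structure (langE S), Th M = T -> e_spectrum M #<= [set: X]) /\
  (forall Y : Type,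
     (forall M : structure (langE S), Th M = T -> e_spectrum M #<= [set: Y]) ->
     [set: X] #<= [set: Y]).

End Spectrum.

(* Main.v *)
Require Import Defs.
From mathcomp Require Import all_boot.
From mathcomp Require Import boolp classical_sets functions cardinality.

(** Take unary predicates only, and combine one-point structures.  Over a set
    [P] of unary symbols a one-point structure is given, up to isomorphism, by
    the set [X] of the predicates that hold at its point; write [point X] for
    it.  A combination of points has equality as its [E], and two distinct sets
    [X] are told apart by a sentence of the form [forall x, R x].

    If every finite pattern of predicates is realised by infinitely many points
    of the combination, its theory does not depend on which points occur: a
    formula only mentions finitely many symbols, so a back-and-forth argument
    that only looks at equalities and at these symbols applies
    ([generic_elem_equiv]).  When [P] is infinite, the finite subsets of [P]
    already provide all patterns infinitely often ([dense_finite]).  Hence the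
    combination of the points [X] with [X] finite is elementarily equivalent to
    the combination of all points, whose classes include the points [X] with
    [X] infinite; each infinite [X] contributes a new theory to the [e]-spectrum
    of the former ([e_spectrum_finite_points]).

    Conversely, that [E] is equality is first-order, so every class of every
    model is a point, and a spectrum has at most as many elements as there are
    subsets of [P] ([e_spectrum_sub]).

    It remains to choose [P] so that its subsets, its infinite subsets and the
    subsets of [L] are equinumerous.  For [P := L + nat] the infinite subsets
    that contain the whole copy of [nat] are enough, and [L + nat] has the
    cardinality of [L] because [L] is infinite. *)

Set Implicit Arguments.
Unset Strict Implicit.
Unset Printing Implicit Defensive.

Local Open Scope classical_set_scope.
Local Open Scope card_scope.

(** * Cardinal arithmetic *)

Lemma inj_on_card_le (T U : Type) (f : T -> U) (A : set T) (B : set U) :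
  {in A &, injective f} -> f @` A `<=` B -> A #<= B.
Proof.
move=> f_inj fAB; apply: card_le_trans (subset_card_le fAB).
by have := inj_card_eq f_inj; rewrite card_eq_le => /andP[].
Qed.

Lemma inj_card_leT (T U : Type) (f : T -> U) :
  injective f -> [set: T] #<= [set: U].
Proof.
by move=> f_inj; apply: (@inj_on_card_le _ _ f) => // x y _ _ /f_inj.
Qed.

Lemma card_leT_inj (T U : Type) :
  [set: T] #<= [set: U] -> exists f : T -> U, injective f.
Proof.
move=> /card_leP[g].
exists (fun x => val (g (SigSub (mem_set I : x \in [set: T])))) => x y.
by move=> /val_inj /inj; rewrite !in_setT => /(_ isT isT) /(congr1 val).
Qed.

(** A copy of [nat] inside [L] is split into its even and its odd terms: the
    even ones accommodate the copy itself, the odd ones the new summand. *)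
Lemma card_sum_nat_le (L : Type) :
  infinite_set [set: L] -> [set: L + nat] #<= [set: L].
Proof.
move=> /infiniteP/card_leT_inj[h h_inj].
pose f (x : L + nat) : L := match x with
  | inl l => if pselect (exists n, l = h n) is left ln
             then h (projT1 (cid ln)).*2 else l
  | inr n => h n.*2.+1
  end.
apply: (@inj_card_leT _ _ f).
have fP x : (exists n, x = inl (h n) /\ f x = h n.*2) \/
    (exists l, [/\ x = inl l, f x = l & forall n, l <> h n]) \/
    (exists n, x = inr n /\ f x = h n.*2.+1).
  case: x => [l|n]; last by right; right; exists n.
  rewrite /f; case: pselect => [ln|nln].
    by left; case: cid => n /= ->; exists n.
  by right; left; exists l; split => // n ln; apply: nln; exists n.
move=> x y; case: (fP x) => [[n [-> ->]]|[[l [-> -> lh]]|[n [-> ->]]]];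
  case: (fP y) => [[m [-> ->]]|[[k [-> -> kh]]|[m [-> ->]]]].
- by move=> /h_inj /double_inj ->.
- by move=> /esym /kh.
- by move=> /h_inj /(congr1 odd) /=; rewrite !odd_double.
- by move=> /lh.
- by move=> ->.
- by move=> /lh.
- by move=> /h_inj /(congr1 odd) /=; rewrite !odd_double.
- by move=> /esym /kh.
- by move=> /h_inj /eq_add_S /double_inj ->.
Qed.

Lemma card_option_sum_nat_le (L : Type) :
  [set: option (L + nat)] #<= [set: L + nat].
Proof.
apply: (@inj_card_leT _ _ (fun x => match x with
  | None => inr 0 | Some (inl l) => inl l | Some (inr n) => inr n.+1 end)).
by move=> [[l|n]|] [[k|m]|] //= => [[->]|[->]].
Qed.

Lemma card_powerset_le (T U : Type) :
  [set: T] #<= [set: U] -> [set: set T] #<= [set: set U].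
Proof.
move=> /card_leT_inj[h h_inj].
apply: (@inj_card_leT _ _ (fun X => h @` X)) => X Y hXY.
by apply/funext => x; rewrite -(image_inj (A := X) h_inj) hXY image_inj.
Qed.

(** * Back-and-forth *)

Fixpoint symbols (S : language) (n : nat) (f : formula S n) : set S :=
  match f with
  | Fal _ => set0
  | Eq _ _ _ => set0
  | Rel _ R _ => [set R]
  | Imp _ g h => symbols g `|` symbols h
  | All _ g => symbols g
  end.

Lemma finite_symbols (S : language) (n : nat) (f : formula S n) :
  finite_set (symbols f).
Proof.
elim: f => {n} //= n g gfin h hfin.
by rewrite finite_setU.
Qed.

(** Restricting the condition on relations to [F] makes it possible to compare
    structures between which no back-and-forth system respects all symbols: it
    is enough to have one system for each finite [F]. *)
Lemma sat_back_and_forth (S : language) (M N : structure S) (F : set S)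
    (Z : forall n, n.-tuple M -> n.-tuple N -> Prop) :
  (forall n (e : n.-tuple M) (e' : n.-tuple N) i j, Z n e e' ->
     (tnth e i = tnth e j <-> tnth e' i = tnth e' j)) ->
  (forall n (e : n.-tuple M) (e' : n.-tuple N) (R : S) v, F R -> Z n e e' ->
     (interp (map_tuple (tnth e) v) <->
      interp (R := R) (map_tuple (tnth e') v))) ->
  (forall n (e : n.-tuple M) (e' : n.-tuple N) x, Z n e e' ->
     exists x', Z n.+1 (cons_tuple x e) (cons_tuple x' e')) ->
  (forall n (e : n.-tuple M) (e' : n.-tuple N) x', Z n e e' ->
     exists x, Z n.+1 (cons_tuple x e) (cons_tuple x' e')) ->
  forall n (f : formula S n), symbols f `<=` F ->
  forall e e', Z n e e' -> (sat f e <-> sat f e').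
Proof.
move=> ZEq ZRel forth back n f; elim: f => {n} /=
  [n|n i j|n R v|n g IHg h IHh|n g IHg] fF e e' Ze //.
- exact: ZEq.
- by apply: ZRel => //; exact: fF.
- have := IHg (fun R gR => fF R (or_introl gR)) e e' Ze.
  have := IHh (fun R hR => fF R (or_intror hR)) e e' Ze.
  by move=> [? ?] [? ?]; split; auto.
- split=> sg x.
    by have [y Zy] := back n e e' x Ze; apply/(IHg fF _ _ Zy).
  by have [y Zy] := forth n e e' x Ze; apply/(IHg fF _ _ Zy).
Qed.

(** * Points over unary predicates *)

Definition unary (P : Type) : language :=
  @Language P (fun=> 1) (fun=> isT).

Definition point (P : Type) (X : set P) : structure (unary P) :=
  @Structure (unary P) unit (fun R _ => X R) (inhabits tt).

Definition profile (P : Type) (M : structure (unary P)) (x : M) : set P :=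
  [set R | interp (R := R : unary P) [tuple x]].

Lemma interp_profile (P : Type) (M : structure (unary P)) (R : P)
    (t : 1.-tuple M) :
  interp (R := R : unary P) t <-> profile (tnth t ord0) R.
Proof.
rewrite /profile /=; suff {1}-> : t = [tuple tnth t ord0] by [].
by apply/eq_from_tnth => i; rewrite !ord1.
Qed.

Lemma Th_point_inj (P : Type) : injective (fun X : set P => Th (point X)).
Proof.
have ThE (X : set P) R :
    Th (point X) (All (@Rel (unary P) 1 R [tuple ord0])) <-> X R.
  by split; [exact: (fun XR => XR tt)|exact: (fun XR _ => XR)].
move=> X Y XY; apply/funext => R; apply/propext.
by apply: (iff_trans (iff_sym (ThE X R))); rewrite XY; exact: ThE.
Qed.

Lemma Th_subsingleton (P : Type) (B : structure (unary P)) (b : B) :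
  (forall x, x = b) -> Th B = Th (point (profile b)).
Proof.
move=> Bb.
suff H (f : formula (unary P) 0) e e' :
    sat (M := B) f e <-> sat (M := point (profile b)) f e'.
  by apply/funext => f; apply/propext; exact: H.
apply: (@sat_back_and_forth _ _ _ setT (fun _ _ _ => True)) => //.
- move=> n {}e {}e' i j _; rewrite [tnth e i]Bb [tnth e j]Bb.
  by case: (tnth e' i) (tnth e' j) => -[].
- move=> n {}e {}e' R v _ _.
  by rewrite (interp_profile (M := B)) [tnth _ _]Bb.
Qed.

(** * Structures whose classes are points *)

Lemma Th_E_restriction (P : Type) (M : structure (langE (unary P))) B :
  (forall x y : M, E x y -> x = y) -> is_E_restriction M B ->
  exists a : reduct M, Th B = Th (point (profile a)).
Proof.
move=> Eeq [C [C0 [[a Ca] ->]]]; exists a.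
have [c Cc] := C0.
have ac : a = c by apply: Eeq; move: Cc; rewrite Ca.
pose b : induced C0 := exist _ c Cc.
rewrite (@Th_subsingleton _ _ b).
  congr (Th (point _)); rewrite /profile /=; apply/funext => R.
  rewrite ac; congr (interp _); exact/val_inj.
move=> [x Cx]; apply: eq_exist; rewrite -ac.
by apply/esym/Eeq; move: Cx; rewrite Ca.
Qed.

Lemma E_restriction_point (P : Type) (M : structure (langE (unary P)))
    (a : reduct M) :
  (forall x y : M, E x y <-> x = y) ->
  exists2 B, is_E_restriction M B & Th B = Th (point (profile a)).
Proof.
move=> Eeq.
have a0 : [set x : reduct M | E (a : M) x] !=set0 by exists a; exact/Eeq.
exists (induced a0); first by exists _, a0; split=> //; exists a.
have aa : E (a : M) a by exact/Eeq.
pose b : induced a0 := exist _ a aa.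
rewrite (@Th_subsingleton _ _ b).
  congr (Th (point _)); rewrite /profile /=; apply/funext => R.
  congr (interp _); exact/val_inj.
by move=> [x ax]; apply: eq_exist; apply/esym/Eeq.
Qed.

(** The hypothesis on [M] is the sentence [forall x y, E x y -> x = y]. *)
Lemma elem_equiv_E_eq (S : language) (M N : structure (langE S)) :
  Th M = Th N -> (forall x y : M, E x y -> x = y) ->
  forall x y : N, E x y -> x = y.
Proof.
move=> MN Meq x y.
pose i1 : 'I_2 := lift ord0 ord0.
pose f : formula (langE S) 0 :=
  All (All (Imp (@Rel (langE S) 2 None [tuple i1; ord0]) (Eq _ i1 ord0))).
have fM : Th M f.
  move=> u v /=; rewrite (_ : map_tuple _ _ = [tuple u; v]); first exact: Meq.
  exact/val_inj.
have : Th N f by rewrite -MN.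
move=> /(_ x y) /=; rewrite (_ : map_tuple _ _ = [tuple x; y]) //.
exact/val_inj.
Qed.

(** The class in question may come from another model [N] of the theory, but [E]
    is contained in equality there too. *)
Lemma e_spectrum_sub (P : Type) (M : structure (langE (unary P))) :
  (forall x y : M, E x y -> x = y) ->
  e_spectrum M `<=` range (fun X : set P => Th (point X)).
Proof.
move=> Meq _ [B [-> [N [NM NB]] _]].
have [a ->] := Th_E_restriction (elem_equiv_E_eq (esym NM) Meq) NB.
by exists (profile a).
Qed.

(** * Generic combinations of points *)

(** Avoiding the entries of a tuple says that each finite pattern is realised
    infinitely often, in the form that a back-and-forth step uses. *)
Definition generic (P : Type) (M : structure (langE (unary P))) : Prop :=
  (forall x y : M, E x y <-> x = y) /\
  (forall (X F : set P) n (e : n.-tuple M), finite_set F ->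
     exists2 x : reduct M, forall i, tnth e i <> x
                         & profile x `&` F = X `&` F).

Definition similar (P : Type) (F : set P) (M N : structure (langE (unary P)))
    n (e : n.-tuple M) (e' : n.-tuple N) : Prop :=
  (forall i j, tnth e i = tnth e j <-> tnth e' i = tnth e' j) /\
  (forall i, profile (tnth e i : reduct M) `&` F =
             profile (tnth e' i : reduct N) `&` F).

Lemma similar_sym (P : Type) (F : set P) (M N : structure (langE (unary P)))
    n (e : n.-tuple M) (e' : n.-tuple N) :
  similar F e e' -> similar F e' e.
Proof.
by move=> [eqe pe]; split=> [i j|i]; [split=> /eqe|rewrite pe].
Qed.

(** An element that already occurs in [e] must be sent to the corresponding
    entry of [e']; a new one needs a new partner with the same trace on [F]. *)
Lemma similar_extend (P : Type) (F : set P)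
    (M N : structure (langE (unary P))) n (e : n.-tuple M) (e' : n.-tuple N)
    (x : M) :
  finite_set F -> generic N -> similar F e e' ->
  exists x' : N, similar F (cons_tuple x e) (cons_tuple x' e').
Proof.
move=> Ffin [_ Ngen] [eqe pe].
have [[k kx]|nkx] := pselect (exists k, tnth e k = x).
  exists (tnth e' k); split=> [i j|i].
    case: (unliftP ord0 i) => [i'|] ->; case: (unliftP ord0 j) => [j'|] ->;
      by rewrite ?tnth0 ?tnthS -?kx // eqe.
  by case: (unliftP ord0 i) => [i'|] ->; rewrite ?tnth0 ?tnthS -?kx.
have [x' x'e' px'] := Ngen (profile (x : reduct M)) F n e' Ffin.
exists x'; split=> [i j|i].
  case: (unliftP ord0 i) => [i'|] ->; case: (unliftP ord0 j) => [j'|] ->;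
    rewrite ?tnth0 ?tnthS; first exact: eqe.
  - split=> [ix|/x'e' //]; by case: nkx; exists i'.
  - split=> [/esym jx|/esym /x'e' //]; by case: nkx; exists j'.
  - by [].
by case: (unliftP ord0 i) => [i'|] ->; rewrite ?tnth0 ?tnthS.
Qed.

(** The theory of a generic structure does not depend on which profiles are
    realised: a sentence only sees the traces of profiles on the finite set of
    its symbols, and all these traces occur infinitely often. *)
Lemma generic_elem_equiv (P : Type) (M N : structure (langE (unary P))) :
  generic M -> generic N -> elem_equiv M N.
Proof.
move=> Mgen Ngen; apply/funext => f; apply/propext.
pose F : set P := Some @^-1` symbols f.
have Ffin : finite_set F.
  apply: (@finite_preimage _ _ (symbols f) Some _ (finite_symbols f)).
  by move=> R R' _ _ [].
apply: (@sat_back_and_forth _ _ _ (symbols f) (@similar P F M N)) => //.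
- by move=> n e e' i j [eqe _].
- move=> n e e' [R|] v fR [eqe pe] /=.
    apply: (iff_trans (@interp_profile _ (reduct M) R _)).
    apply: iff_trans; last exact: iff_sym (@interp_profile _ (reduct N) R _).
    rewrite !tnth_map.
    have /seteqP[eF e'F] := pe (tnth v ord0).
    by split=> Rv; [have [] := eF R (conj Rv fR)|have [] := e'F R (conj Rv fR)].
  have pairE (T : Type) (t : 2.-tuple T) :
      t = [tuple tnth t ord0; tnth t ord_max].
    by apply/eq_from_tnth => -[[|[]] //= ?]; congr tnth; exact/val_inj.
  rewrite (pairE _ (map_tuple (tnth e) v)) (pairE _ (map_tuple (tnth e') v)).
  rewrite !tnth_map -/(E _ _) -/(E (M := N) _ _).
  by rewrite (Mgen.1 _ _) (Ngen.1 _ _); exact: eqe.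
- by move=> n e e' x; exact: similar_extend.
- move=> n e e' x' /similar_sym see'.
  have [x sx] := similar_extend x' Ffin Mgen see'.
  by exists x; exact: similar_sym.
- by split=> [[]|[]].
Qed.

(** The condition on a set of profiles that makes the combination of the
    corresponding points generic. *)
Definition dense (P : Type) (K : set (set P)) : Prop :=
  forall X F : set P, finite_set F ->
    infinite_set [set Y | K Y /\ Y `&` F = X `&` F].

Definition point_comb (P : Type) (K : set (set P)) (K0 : inhabited {X | K X}) :
    structure (langE (unary P)) :=
  comb K0 (fun X : {X | K X} => point (sval X)).

Lemma profile_point_comb (P : Type) (K : set (set P)) K0
    (x : reduct (@point_comb P K K0)) : profile x = sval (tag x).
Proof.
apply/seteqP; split=> R /=.
  move=> [X [u [/(congr1 (fun t => tag (tnth t ord0)))]]] /=.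
  by rewrite tnth_map (tnth_nth x) /= => ->.
move=> xR; exists (tag x), [tuple tt]; split => //.
by case: x {xR} => X []; exact/val_inj.
Qed.

Lemma E_point_comb (P : Type) (K : set (set P)) K0
    (x y : @point_comb P K K0) : E x y <-> x = y.
Proof.
split=> [|->//]; rewrite /E /= !(tnth_nth x) /=.
by case: x y => X [] [Y []] /= ->.
Qed.

Lemma generic_point_comb (P : Type) (K : set (set P)) K0 :
  dense K -> generic (@point_comb P K K0).
Proof.
move=> Kdense; split=> [x y|X F n e Ffin]; first exact: E_point_comb.
have efin : finite_set (range (fun i => sval (tag (tnth e i)))).
  exact/finite_image/finite_finset.
have /infinite_setN0 [Y [[KY YX] Ye]] := infinite_setD (Kdense X F Ffin) efin.
exists (existT (fun X : {X | K X} => point (sval X)) (exist _ Y KY) tt).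
  by move=> i ei; apply: Ye; exists i => //; rewrite ei.
by rewrite profile_point_comb.
Qed.

(** The trace of [X] on [F] is extended by one element outside [F], in
    infinitely many ways. *)
Lemma dense_finite (P : Type) :
  infinite_set [set: P] -> dense [set X : set P | finite_set X].
Proof.
move=> Pinf X F Ffin.
have FCinf : infinite_set (~` F) by rewrite -setTD; exact: infinite_setD.
pose Y s := (X `&` F) `|` [set s].
have Y_inj : {in ~` F &, injective Y}.
  move=> s s'; rewrite !inE => sF _ Yss'.
  have : Y s s by right.
  by rewrite Yss' => -[[_ /sF]|].
apply: (@sub_infinite_set _ (Y @` (~` F))) => [_ [s sF <-]|Yfin].
  split; first by rewrite /= finite_setU; split => //; exact: finite_setIr.
  rewrite /Y setIUl -setIA setIid (_ : [set s] `&` F = set0) ?setU0 //.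
  by apply/seteqP; split=> // ? [-> /sF].
exact: FCinf (card_le_finite (inj_on_card_le Y_inj (fun _ H => H)) Yfin).
Qed.

Lemma sub_dense (P : Type) (K K' : set (set P)) :
  K `<=` K' -> dense K -> dense K'.
Proof.
move=> KK' Kdense X F /(Kdense X); apply: sub_infinite_set.
by move=> Y [/KK'].
Qed.

(** The witness for an infinite [X] is its class in the combination of all
    points, which is elementarily equivalent to that of the finite ones. *)
Lemma e_spectrum_finite_points (P : Type)
    (K0 : inhabited {X : set P | finite_set X}) :
  infinite_set [set: P] ->
  (fun X => Th (point X)) @` [set X : set P | infinite_set X] `<=`
  e_spectrum (@point_comb P [set X : set P | finite_set X] K0).
Proof.
move=> Pinf _ [X Xinf <-].
have finD := dense_finite Pinf.
have T0 : inhabited {X : set P | [set: set P] X} by exists; exists set0.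
have allD : dense [set: set P] by exact: sub_dense finD.
pose x : reduct (point_comb T0) :=
  existT (fun X : {X | [set: set P] X} => point (sval X)) (exist _ X I) tt.
have [B Bx ThB] := E_restriction_point x (@E_point_comb _ _ _).
rewrite profile_point_comb /= in ThB.
exists B; split => //.
  by exists (point_comb T0); split => //; apply: generic_elem_equiv;
    exact: generic_point_comb.
move=> [C [CK BC]].
have [y ThC] := Th_E_restriction (fun x y => (E_point_comb x y).1) CK.
move: BC; rewrite /elem_equiv ThB ThC profile_point_comb => /Th_point_inj XE.
by apply: Xinf; rewrite XE; exact: (svalP (tag y)).
Qed.

Theorem proposition4p4 (L : Type) (hL : infinite_set [set: L]) :
  exists (S : language) (I : Type) (I0 : inhabited I) (A : I -> structure S),
    [set: symbol (langE S)] #= [set: L] /\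
    e_Sp_is (Th (comb I0 A)) (set L).
Proof.
pose P := (L + nat)%type.
have PL : [set: P] #<= [set: L] := card_sum_nat_le hL.
have Pinf : infinite_set [set: P].
  by apply/infiniteP; apply: (@inj_card_leT _ _ (@inr L nat)) => m n [].
have K0 : inhabited {X : set P | finite_set X}.
  by exists; exists set0; exact: finite_set0.
exists (unary P), {X : set P | finite_set X}, K0, (fun X => point (sval X)).
split.
  rewrite card_eq_le (card_le_trans (card_option_sum_nat_le L) PL) /=.
  by apply: (@inj_card_leT _ _ (fun l => Some (inl l))) => l k [].
rewrite -/(point_comb K0); split=> [M MT|Y /(_ _ erefl)].
  have Meq : forall x y : M, E x y -> x = y.
    exact: elem_equiv_E_eq (esym MT) (fun x y => (E_point_comb x y).1).
  apply: card_le_trans (subset_card_le (e_spectrum_sub Meq)) _.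
  by apply: card_le_trans (card_image_le _ _) (card_powerset_le PL).
apply: card_le_trans.
(* Adding all of [nat] makes every subset of [L] infinite, injectively. *)
pose full (X : set L) : set P := [set p | if p is inl l then X l else True].
apply: (@inj_on_card_le _ _ (fun X => Th (point (full X)))).
  move=> X X' _ _ /Th_point_inj XX'; apply/funext => l.
  exact: (congr1 (fun Y : set P => Y (inl l)) XX').
move=> _ [X _ <-]; apply: e_spectrum_finite_points => //.
exists (full X) => //.
apply: (@sub_infinite_set _ (range (@inr L nat))) => [_ [n _ <-] //|].
apply/infiniteP; apply: (@inj_on_card_le _ _ (@inr L nat)) => //.
by move=> m n _ _ [].
Qed.
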